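(* Let $F$ be a field of characteristic $p>0$ and let $G$ be a finite $p$-group. Then $\operatorname{soc}(ZFG)$ is an ideal in $FG$ if and only if at least one of the following holds: (i) $G$ has nilpotency class at most two, that is, $G' \subseteq Z(G)$; or (ii) $p=2$ and $G' \subseteq Y(G)Z(G)$, where $Y(G) = \langle fg^{-1} : \{f,g\} \text{ is a conjugacy class of length } 2 \text{ of } G\rangle$. In particular, if $\operatorname{soc}(ZFG)$ is an ideal in $FG$, then $G$ is metabelian.
   Context: $FG$ is the group algebra of $G$ over $F$, $ZFG$ is its center, and ''ideal'' of $FG$ means two-sided ideal. $\operatorname{soc}(ZFG)$ denotes the socle of the commutative finite-dimensional algebra $ZFG$, i.e. the sum of its minimal ideals; equivalently, the annihilator in $ZFG$ of the Jacobson radical $J(ZFG)$. $G'$ is the derived subgroup and $Z(G)$ the center of $G$. *)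

(* Defs.v *)
From HB Require Import structures.
From mathcomp Require Import all_boot all_order all_algebra all_fingroup.
From mathcomp Require Import all_solvable all_character.
From mathcomp Require Import boolp.

Set Implicit Arguments.
Unset Strict Implicit.
Unset Printing Implicit Defensive.

Import GRing.Theory.
Local Open Scope ring_scope.

(* The library's [mx_ideal A I] only states closure under multiplication by A;
   it does not include I <= A. *)
Definition is_ideal (F : fieldType) (m n : nat)
    (A : 'A[F]_(m, n)) (I : 'A[F]_n) : bool :=
  (I <= A)%MS && mx_ideal A I.

Definition minimal_ideal (F : fieldType) (m n : nat)
    (A : 'A[F]_(m, n)) (I : 'A[F]_n) : Prop :=
  [/\ is_ideal A I, I != 0
    & forall J : 'A[F]_n,
        is_ideal A J -> J != 0 -> (J <= I)%MS -> (J == I)%MS].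

(* The sum of a possibly infinite family of subspaces is the least subspace
   containing all its members. *)
Definition is_socle (F : fieldType) (m n : nat)
    (A : 'A[F]_(m, n)) (S : 'A[F]_n) : Prop :=
  (forall I : 'A[F]_n, minimal_ideal A I -> (I <= S)%MS) /\
  (forall U : 'A[F]_n,
     (forall I : 'A[F]_n, minimal_ideal A I -> (I <= U)%MS) -> (S <= U)%MS).

Lemma socle_exists (F : fieldType) (m n : nat) (A : 'A[F]_(m, n)) :
  exists S : 'A[F]_n, is_socle A S.
Proof.
pose P k := `[< exists s : seq 'A[F]_n,
  (forall I, I \in s -> minimal_ideal A I) /\ \rank (\sum_(I <- s) I)%MS = k >].
have exP : exists k, P k.
  by exists 0%N; apply/asboolP; exists [::]; rewrite big_nil mxrank0.
have leP k : P k -> (k <= n ^ 2)%N.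
  by move=> /asboolP[s [_ <-]]; apply: rank_leq_row.
case: (ex_maxnP exP leP) => k /asboolP[s [sP rk]] kmax.
exists (\sum_(I <- s) I)%MS; split=> [I minI | U UP]; last first.
  by rewrite big_seq; elim/big_rec: _ => [|J V /sP/UP JU VU];
     rewrite ?sub0mx // addsmx_sub JU.
have := kmax (\rank (\sum_(J <- I :: s) J)%MS) _.
rewrite big_cons -rk => /(_ _) le_rk.
have sub : (\sum_(J <- s) J <= I + \sum_(J <- s) J)%MS by apply: addsmxSr.
have /le_rk le : P (\rank (I + \sum_(J <- s) J)%MS).
  apply/asboolP; exists (I :: s); rewrite big_cons; split=> // J.
  by rewrite inE => /predU1P[-> // | /sP].
apply: submx_trans (addsmxSl I (\sum_(J <- s) J)%MS) _.
by have [_ <-] := mxrank_leqif_sup sub; rewrite eqn_leq le mxrankS.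
Qed.

(* Any two choices have the same row space. *)
Definition soc (F : fieldType) (m n : nat) (A : 'A[F]_(m, n)) : 'A[F]_n :=
  sval (cid (socle_exists A)).

Lemma socP (F : fieldType) (m n : nat) (A : 'A[F]_(m, n)) : is_socle A (soc A).
Proof. exact: svalP (cid (socle_exists A)). Qed.

Definition Y (gT : finGroupType) (G : {group gT}) : {group gT} :=
  <<[set f * g^-1 | f in G, g in G
       & ([set f; g] \in classes G) && (#|[set f; g]| == 2%N)]%g>>%G.

(* Main.v *)
Require Import Defs.
From HB Require Import structures.
From mathcomp Require Import all_boot all_order all_algebra all_fingroup.
From mathcomp Require Import all_solvable all_character.

Set Implicit Arguments.
Unset Strict Implicit.
Unset Printing Implicit Defensive.

(** The algebra FG of a p-group in characteristic p has nilpotent augmentation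
    ideal, so the socle of ZFG consists of the central elements A killed by
    every element of ZFG of augmentation zero: A is killed by the sums of the
    noncentral classes and fixed by multiplication by Z(G) ([mem_soc]).
    If soc(ZFG) is an ideal, then all its multiples A x are central, and
    comparing A x y with A y x shows that A is fixed by every commutator;
    conversely, if G' fixes every element of the socle, then multiplying by a
    group element preserves the three conditions.  Hence soc(ZFG) is an ideal
    if and only if G' fixes all its elements ([soc_idealP]).

    Sufficiency is then immediate.  If G' lies in Z(G), it fixes the socle.  If
    p = 2 and {f, g} is a class, then A f + A g = 0 means A f = A g, so f g^-1
    fixes A ([Y_fixes_soc]); so Y(G)Z(G), and therefore G', fixes the socle.

    For necessity one exhibits, when the group condition fails, an element of
    the socle which G' moves.  Put K = G'Z(G), and let N be a normal subgroup of
    G of index p in K, with K/N central in G/N ([normal_index_p]).  Write S^+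
    for the sum of a set S and let C be a noncentral class.  The coefficient of
    C^+ N^+ at h is the number of elements of C in the coset hN; if two
    elements of C share a coset of N, this number is always divisible by p
    ([dvdn_card_class_coset]), so that C^+ N^+ = 0.
    - If p = 2 and G' is not in Y(G)Z(G), choose N containing Y(G)Z(G).  Two
      elements of C always share a coset of N: as C lies in a coset of K, which
      consists of two cosets of N, the class C would otherwise have length 2,
      and then Y(G) <= N forces its elements into one coset.  So N^+ lies in
      the socle, and it is fixed only by N, which does not contain G'.
    - If p is odd and G' is not in Z(G), choose N containing Z(G), and z in G'
      outside N.  Then N^+(z - 1) lies in the socle: if C^+ N^+ is not zero, it
      is the sum of CN, and K preserves CN by right translation
      ([gset_class_annihilated]).  But z does not fix
      N^+(z - 1), because N^+(z - 1)^2 is nonzero when p is odd.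

    Finally, an element of a class of length 2 has a centralizer of index 2,
    which contains G'.  So Y(G) centralizes G', and G' is abelian whenever it
    is contained in Y(G)Z(G). *)

(** * Classes, cosets and the subgroup Y(G) of a group *)

Section GroupTheory.

Import GroupScope.

Lemma conj_mem_lcoset (gT : finGroupType) (N : {group gT}) x y t :
  t \in 'N(N) -> (x ^ t \in y ^ t *: N)%g = (x \in y *: N)%g.
Proof.
by move=> nNt; rewrite !mem_lcoset -conjVg -conjMg memJ_norm.
Qed.

(** The elements of the class of f in fN form the class of f under the
    normalizer of fN, so their number is a power of p; it is not 1 as soon as
    one element of the class is not alone in its coset. *)
Lemma dvdn_card_class_coset (p : nat) (gT : finGroupType) (G N : {group gT})
    x h :
  p.-group G -> N <| G -> x \in G ->
  (exists2 t, t \in G & (x ^ t != x) && (x ^ t \in x *: N)) ->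
  p %| #|x ^: G :&: (h *: N)|.
Proof.
move=> pG /andP[sNG nNG] Gx [t Gt /andP[xt_x xt_xN]].
have [-> | [f]] := set_0Vmem (x ^: G :&: (h *: N)%g); first by rewrite cards0.
case/setIP=> /imsetP[s Gs def_f] hNf.
have <- : (f *: N = h *: N)%g by apply/lcoset_eqP.
have <- : f ^: G = x ^: G by apply: class_eqP; rewrite def_f memJ_class.
have memH g : g \in G -> (g \in 'N_G(f *: N)) = (f ^ g \in f *: N)%g.
  move=> Gg; rewrite inE Gg inE /= conjsMg conjg_set1 (normsP nNG) //.
  apply/idP/idP=> [/subsetP-> // | fgN].
    exact: (lcoset_refl N (f ^ g)).
  by have /lcoset_eqP<- := fgN.
have -> : f ^: G :&: (f *: N)%g = f ^: 'N_G(f *: N).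
  apply/setP=> y; rewrite inE; apply/andP/imsetP=> [[/imsetP[g Gg ->]] | [g]].
    by rewrite -memH // => Hg; exists g.
  move=> Hg ->; have Gg := subsetP (subsetIl _ _) g Hg.
  by rewrite memJ_class // -memH.
rewrite -index_cent1.
have: p.-nat #|'N_G(f *: N) : 'C_('N_G(f *: N))[f]|.
  exact: pnat_dvd (dvdn_indexg _ _) (pgroupS (subsetIl _ _) pG).
case/p_natP=> [] [/eqP | k ->]; last by rewrite expnS dvdn_mulr.
rewrite indexg_eq1 subsetI subxx sub_cent1 => cHf.
have: (t ^ s)%g \in 'N_G(f *: N).
  by rewrite memH ?groupJ // def_f -conjJg conj_mem_lcoset // (subsetP nNG).
move/(centP cHf) => cft; case/eqP: xt_x; apply: (@conjg_inj _ s).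
by rewrite conjJg -def_f conjgE cft mulKg.
Qed.

(** A chief series of the p-group G through M and K has factors of order p, and
    a normal subgroup of order p of a p-group is central. *)
Lemma normal_index_p (p : nat) (gT : finGroupType) (G K M : {group gT}) :
  p.-group G -> K <| G -> M <| G -> M \proper K ->
  exists N : {group gT},
    [/\ N <| G, M \subset N, N \subset K, #|K : N| = p & [~: K, G] \subset N].
Proof.
move=> pG nsKG nsMG /andP[sMK nsKM].
have nsMK : M <| K := normalS sMK (normal_sub nsKG) nsMG.
have pGM : p.-group (G / M) := quotient_pgroup M pG.
have nsKM' : K / M <| G / M := quotient_normal M nsKG.
have pKM : p.-group (K / M) := pgroupS (normal_sub nsKM') pGM.
have ntKM : (K / M != 1)%g.
  by rewrite -subG1 quotient_sub1 // normal_norm.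
have [p_pr p_dv [k oKM]] := pgroup_pdiv pKM ntKM.
have [|Q [sQK nsQ oQ]] := @normal_pgroup p _ k _ _ pGM nsKM'.
  by rewrite oKM pfactorK.
have [N defQ sMN nsNG] := inv_quotientN nsMG nsQ.
have nMN := subset_trans (normal_sub nsNG) (normal_norm nsMG).
have sNK : N \subset K by rewrite -(quotientSGK nMN sMK) -defQ.
have nsNK := normalS sNK (normal_sub nsKG) nsNG.
have iKN : #|K : N| = p.
  rewrite -(@index_quotient_eq _ K M) ?(normal_norm nsMK) //; last first.
    exact: subset_trans (subsetIr _ _) sMN.
  rewrite -defQ -divgS //= [#|K / M|%g]oKM oQ expnS mulnK //.
  by rewrite expn_gt0 prime_gt0.
exists N; split=> //.
have nsKN : K / N <| G / N := quotient_normal N nsKG.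
have pKN : prime #|K / N| by rewrite card_quotient ?normal_norm // iKN.
rewrite -quotient_cents2 ?normal_norm //.
have: K / N :&: 'Z(G / N) != 1.
  rewrite meet_center_nil ?(pgroup_nil (quotient_pgroup N pG)) //.
  by rewrite -cardG_gt1 prime_gt1.
by move/(prime_meetG pKN)=> /subset_trans; apply; apply: subsetIr.
Qed.

Section ClassesOfLengthTwo.

Variables (gT : finGroupType) (G : {group gT}).

Lemma Y_gen_in_der1 f g :
  [set f; g] \in classes G -> f * g^-1 \in G^`(1).
Proof.
case/imsetP=> x Gx def_fg.
have /imsetP[s Gs ->] : f \in x ^: G by rewrite -def_fg set21.
have /imsetP[t Gt ->] : g \in x ^: G by rewrite -def_fg set22.
have -> : x ^ s = (x ^ t) ^ (t^-1 * s) by rewrite -conjgM mulKVg.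
have -> : (x ^ t) ^ (t^-1 * s) * (x ^ t)^-1 = [~ t^-1 * s, (x ^ t)^-1].
  by rewrite /commg /conjg !invgK !mulgA.
by rewrite mem_commg ?groupM ?groupV ?groupJ.
Qed.

Lemma Y_sub_der1 : Y G \subset G^`(1).
Proof.
rewrite gen_subG; apply/subsetP=> _ /imset2P[f g Gf /[!inE] + ->].
by case/and3P=> _ fgG _; apply: Y_gen_in_der1.
Qed.

Lemma Y_normal : Y G <| G.
Proof.
rewrite /normal (subset_trans Y_sub_der1 (der_sub 1 G)) norms_gen //.
apply/subsetP=> t Gt; rewrite inE.
apply/subsetP=> _ /imsetP[_ /imset2P[f g Gf /[!inE] + ->] ->].
case/and3P=> Gg fgG card2; rewrite conjMg conjVg.
apply: imset2_f; rewrite ?groupJ // inE groupJ //=.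
have -> : [set f ^ t; g ^ t] = [set f; g] :^ t by rewrite conjUg !conjg_set1.
rewrite cardJg card2 andbT.
by case/imsetP: fgG => x Gx ->; rewrite (normsP (class_norm x G)) ?mem_classes.
Qed.

(** The centralizer of f has index 2, so it is normal with abelian quotient. *)
Lemma der1_sub_cent1 f : f \in G -> #|f ^: G| = 2 -> G^`(1) \subset 'C[f].
Proof.
move=> Gf; rewrite -index_cent1 => i2; apply: subset_trans (subsetIr G _).
have nsCG := index2_normal (subsetIl _ _) i2.
rewrite der1_min ?normal_norm // cyclic_abelian ?prime_cyclic //.
by rewrite card_quotient ?normal_norm // i2.
Qed.

Lemma Y_cent_der1 : Y G \subset 'C(G^`(1)).
Proof.
rewrite gen_subG; apply/subsetP=> _ /imset2P[f g Gf /[!inE] + ->].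
case/and3P=> Gg /imsetP[x Gx def_fg] /eqP card2.
have cent1 y : y \in [set f; g] -> y \in 'C(G^`(1)).
  move=> fgy; rewrite -sub_cent1 der1_sub_cent1 //.
    by rewrite (subsetP (class_subG Gx (subxx G))) // -def_fg.
  by rewrite def_fg in fgy card2; rewrite (class_eqP fgy).
by rewrite groupM ?groupV ?cent1 ?set21 ?set22.
Qed.

(** Both Y(G) and Z(G) centralize G'. *)
Lemma abelian_der1 : G^`(1) \subset Y G * 'Z(G) -> abelian G^`(1).
Proof.
move/subset_trans; apply; rewrite mul_subG ?Y_cent_der1 //.
exact: subset_trans (subsetIr _ _) (centS (der_sub 1 G)).
Qed.

(** Y(G) is generated by the right quotients f g^-1; being normal, it also
    contains the left quotients. *)
Lemma mem_Y f x : f \in G -> x \in G -> #|f ^: G| = 2 -> f ^ x != f ->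
  f^-1 * f ^ x \in Y G.
Proof.
move=> Gf Gx card2 ne_fx.
have def_cl : [set f; f ^ x] = f ^: G.
  apply/eqP; rewrite eqEcard cards2 card2 eq_sym ne_fx andbT.
  by rewrite subUset !sub1set class_refl memJ_class.
have fY : f ^ x * f^-1 \in Y G.
  apply: mem_gen; apply: imset2_f; rewrite ?groupJ // inE Gf setUC def_cl.
  by rewrite mem_classes ?card2.
have nYf : f \in 'N(Y G) by rewrite (subsetP (normal_norm Y_normal)).
by rewrite -(memJ_norm _ nYf) (conjgE (f ^ x * _)) mulgKV in fY.
Qed.

(** Otherwise the conjugates of f lie in distinct cosets of N.  As they differ
    from f by elements of K, there are at most two of them, so f has a class of
    length 2; but then Y(G) <= N puts both in the same coset. *)
Lemma exists_conj_in_lcoset (N K : {group gT}) f :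
  N <| G -> N \subset K -> #|K : N| = 2 -> G^`(1) \subset K -> Y G \subset N ->
  f \in G -> f \notin 'Z(G) ->
  exists2 t, t \in G & (f ^ t != f) && (f ^ t \in f *: N).
Proof.
move=> nsNG sNK i2 sG'K sYN Gf nZf; have nNG := normal_norm nsNG.
apply/exists_inP; apply: contraR nZf; rewrite negb_exists_in => /forall_inP nex.
have fixN t : t \in G -> f ^ t \in f *: N -> f ^ t = f.
  by move=> Gt fN; apply/eqP; apply: contraR (nex t Gt) => ->; rewrite fN.
rewrite inE Gf; apply/centP=> x Gx; apply/commgP/conjg_fixP/eqP.
apply/negPn/negP=> ne_fx; have [card2 | /negP[]] := eqVneq #|f ^: G| 2.
  by have := nex x Gx; rewrite ne_fx mem_lcoset (subsetP sYN) ?mem_Y.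
(* A third conjugate f ^ t would lie in the same coset of N as f ^ x, since
   N has index 2 in K. *)
suff <- : [set f; f ^ x] = f ^: G by rewrite cards2 (eq_sym f) ne_fx.
have comK t : t \in G -> f ^ t != f -> f^-1 * f ^ t \in K :\: N.
  move=> Gt ne_ft; rewrite inE -mem_lcoset.
  have := nex t Gt; rewrite ne_ft => -> /=.
  by rewrite -commgEl (subsetP sG'K) // mem_commg.
apply/eqP; rewrite eqEsubset subUset !sub1set class_refl memJ_class //=.
apply/subsetP=> _ /imsetP[t Gt ->]; rewrite !inE.
have [//|ne_ft /=] := eqVneq.
have := comK t Gt ne_ft; rewrite -(rcoset_index2 sNK i2 (comK x Gx ne_fx)).
rewrite norm_rlcoset ?(subsetP nNG) ?groupM ?groupV ?groupJ // mem_lcoset.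
rewrite invMg invgK mulgA mulgK -mem_lcoset -{1}(mulgKV x t) conjgM.
rewrite conj_mem_lcoset ?(subsetP nNG) // => /fixN fix_tx.
by rewrite -(mulgKV x t) conjgM fix_tx ?groupM ?groupV.
Qed.

End ClassesOfLengthTwo.

End GroupTheory.

(** * The socle of the center of the group algebra *)

Section GroupAlgebra.

Import GroupScope GRing.Theory.
Local Open Scope ring_scope.

Lemma pgroup_fixed_row (F : fieldType) (p : nat) (gT : finGroupType)
    (G : {group gT}) (n : nat) (rG : mx_representation F G n) (U : 'M_n) :
  p \in [pchar F] -> p.-group G -> mxmodule rG U -> U != 0 ->
  exists v : 'rV_n, [/\ (v <= U)%MS, v != 0 & (v <= rfix_mx rG G)%MS].
Proof.
move=> charF pG modU nzU.
have: (U :&: rfix_mx rG G)%MS != 0.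
  rewrite -(in_submodK (capmxSl _ _)) val_submod_eq0 -submx0.
  rewrite -(rfix_submod modU) // submx0 (rfix_pgroup_pchar charF) //.
  by rewrite lt0n mxrank_eq0.
by case/rowV0Pn=> v; rewrite sub_capmx => /andP[vU vG] nz_v; exists v.
Qed.

Section Socle.

Variables (F : fieldType) (gT : finGroupType) (G : {group gT}).

Local Notation n := #|G|.
Local Notation aG := (regular_repr F G).
Local Notation FG := (group_ring F G).
Local Notation gset := (gset_mx F G).

Lemma center_comm A B : (A \in 'Z(FG))%MS -> (B \in FG)%MS -> A *m B = B *m A.
Proof. by case/center_mxP=> _ /(_ B) /[apply]. Qed.

Lemma center_ring A : (A \in 'Z(FG))%MS -> (A \in FG)%MS.
Proof. by case/center_mxP. Qed.

Lemma centerP A :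
  (A \in FG)%MS -> (forall x, x \in G -> A *m aG x = aG x *m A) ->
  (A \in 'Z(FG))%MS.
Proof.
move=> RA cA; rewrite sub_capmx RA memmx_cent_envelop.
exact/centgmxP.
Qed.

Lemma gset_ring (S : {set gT}) : S \subset G -> (gset S \in FG)%MS.
Proof.
move=> sSG; rewrite /gset_mx linear_sum summx_sub // => x Sx.
by rewrite envelop_mx_id // (subsetP sSG).
Qed.

Lemma gset_mull (S : {set gT}) x :
  x \in G -> S \subset G -> aG x *m gset S = gset (x *: S)%g.
Proof.
move=> Gx sSG; rewrite /gset_mx mulmx_sumr.
rewrite -lcosetE (big_imset _ (in2W (@mulgI _ x))) /=.
by apply: eq_bigr => y Sy; rewrite repr_mxM // (subsetP sSG).
Qed.

Lemma gset_mulr (S : {set gT}) x :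
  x \in G -> S \subset G -> gset S *m aG x = gset (S :* x)%g.
Proof.
move=> Gx sSG; rewrite /gset_mx mulmx_suml.
rewrite -rcosetE (big_imset _ (in2W (@mulIg _ x))) /=.
by apply: eq_bigr => y Sy; rewrite repr_mxM // (subsetP sSG).
Qed.

Lemma gset_normal_center (N : {group gT}) : N <| G -> (gset N \in 'Z(FG))%MS.
Proof.
case/andP=> sNG nNG; apply: centerP => [|x Gx]; first exact: gset_ring.
by rewrite gset_mull ?gset_mulr // norm_rlcoset // (subsetP nNG).
Qed.

Lemma gset_class_center x : x \in G -> (gset (x ^: G) \in 'Z(FG))%MS.
Proof.
move=> Gx; rewrite -(classg_base_center F G).
apply: eq_row_sub (enum_rank_in (mem_classes Gx) (x ^: G)) _.
by rewrite rowK enum_rankK_in // mem_classes.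
Qed.

Lemma center_elt z : z \in 'Z(G) -> (aG z \in 'Z(FG))%MS.
Proof.
case/setIP=> Gz cGz; apply: centerP => [|x Gx]; first by rewrite envelop_mx_id.
by rewrite -!repr_mxM // (centP cGz).
Qed.

Lemma fixed_row_mul_gset (S : {set gT}) (v : 'rV_n) :
  S \subset G -> (v <= rfix_mx aG G)%MS -> v *m gset S = #|S|%:R *: v.
Proof.
move=> sSG /rfix_mxP fix_v; rewrite mulmx_sumr.
rewrite (eq_bigr (fun _ => v)) => [|x Sx]; last by rewrite fix_v ?(subsetP sSG).
by rewrite sumr_const scaler_nat.
Qed.

Lemma mem_annihilator (j B : 'M[F]_n) :
  (B \in kermx (lin_mx (mulmxr j) : 'M_(n * n)))%MS = (B *m j == 0).
Proof.
by rewrite -mxvec_eq0 -(mul_vec_lin (mulmxr j)); apply/sub_kermxP/eqP.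
Qed.

(** The hypothesis on the fixed rows says that j has augmentation zero.  The
    elements of I killed by j form an ideal, so by minimality it is enough to
    find a nonzero one.  If B in I is central, its row space is a G-module, so
    for B <> 0 it contains a nonzero fixed row, which j kills.  Thus B j has
    smaller rank than B, and multiplying repeatedly by j finally gives 0. *)
Lemma minimal_ideal_annihilated p (I : 'A[F]_n) (j A : 'M_n) :
  p \in [pchar F] -> p.-group G -> minimal_ideal 'Z(FG)%MS I ->
  (j \in 'Z(FG))%MS ->
  (forall v : 'rV_n, (v <= rfix_mx aG G)%MS -> v *m j = 0) ->
  (A \in I)%MS -> A *m j = 0.
Proof.
move=> charF pG [/andP[sIZ /andP[idl idr]] nzI minI] Zj fix_j IA.
pose K := kermx (lin_mx (mulmxr j) : 'M_(n * n)).
suff: (I <= K)%MS by move/memmx_subP/(_ A IA); rewrite mem_annihilator => /eqP.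
pose J := (I :&: K)%MS.
suff /andP[_]: (J == I)%MS by move/submx_trans; apply; apply: capmxSr.
have memJ B : (B \in J)%MS = (B \in I)%MS && (B *m j == 0).
  by rewrite sub_capmx mem_annihilator.
apply: minI; last exact: capmxSl.
  apply/and3P; split; first exact: submx_trans (capmxSl _ _) sIZ.
    apply/mulsmx_subP=> B C ZB; rewrite !memJ => /andP[IC /eqP Cj0].
    by rewrite (mulsmx_subP idl) // -mulmxA Cj0 mulmx0 eqxx.
  apply/mulsmx_subP=> B C; rewrite !memJ => /andP[IB /eqP Bj0] ZC.
  rewrite (mulsmx_subP idr) // -mulmxA (center_comm ZC) ?center_ring //.
  by rewrite mulmxA Bj0 mul0mx eqxx.
have [B0 IB0 nzB0] : exists2 B, (B \in I)%MS & B != 0.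
  have /rowV0Pn[v Iv nzv] := nzI.
  by exists (vec_mx v); rewrite ?vec_mxK // -mxvec_eq0 vec_mxK.
suff [B [IB nzB Bj0]] : exists B : 'M_n, [/\ (B \in I)%MS, B != 0 & B *m j = 0].
  apply: contraNneq nzB => J0; have: (B \in J)%MS by rewrite memJ IB Bj0 eqxx.
  by rewrite J0 => /memmx0->.
have [m] := ubnP (\rank B0); elim: m => // m IHm in B0 IB0 nzB0 * => le_m.
have [B0j0 | nzB0j] := eqVneq (B0 *m j) 0; first by exists B0.
apply: IHm nzB0j _; first by rewrite (mulsmx_subP idr).
rewrite ltnS in le_m; apply: leq_trans le_m; rewrite -(mxrank_mul_ker B0 j).
rewrite -[X in (X < _)%N]addn0 ltn_add2l lt0n mxrank_eq0.
have modB : mxmodule aG B0.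
  apply/mxmoduleP=> x Gx.
  by rewrite (center_comm (submx_trans IB0 sIZ)) ?envelop_mx_id // submxMl.
have [v [Bv nz_v fix_v]] := pgroup_fixed_row charF pG modB nzB0.
apply: contraNneq nz_v => ker0; rewrite -submx0 -ker0 sub_capmx Bv.
by apply/sub_kermxP; apply: fix_j.
Qed.

Lemma soc_annihilated p (j A : 'M_n) :
  p \in [pchar F] -> p.-group G -> (j \in 'Z(FG))%MS ->
  (forall v : 'rV_n, (v <= rfix_mx aG G)%MS -> v *m j = 0) ->
  (A \in soc 'Z(FG)%MS)%MS -> A *m j = 0.
Proof.
move=> charF pG Zj fix_j socA; have [_ leastU] := socP 'Z(FG)%MS.
apply/eqP; rewrite -mem_annihilator; apply: submx_trans socA _.
apply: leastU => I minI; apply/memmx_subP=> B IB; rewrite mem_annihilator.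
by rewrite (minimal_ideal_annihilated charF pG minI Zj).
Qed.

(** Sums of noncentral classes and the differences z - 1 with z in Z(G) have
    augmentation zero, which gives one direction.  Conversely, the class sums
    span ZFG, so under these conditions A ZFG is contained in the line spanned
    by A, and this line is a minimal ideal if A is not 0. *)
Lemma mem_soc p (A : 'M_n) : p \in [pchar F] -> p.-group G ->
  (A \in soc 'Z(FG)%MS)%MS <->
  [/\ (A \in 'Z(FG))%MS,
      forall x, x \in G -> x \notin 'Z(G) -> A *m gset (x ^: G) = 0
    & 'Z(G) \subset rstab aG A].
Proof.
move=> charF pG; have [socU leastU] := socP 'Z(FG)%MS; split.
  move=> socA.
  have annih j Zj fix_j := @soc_annihilated p j A charF pG Zj fix_j socA.
  split.
  - by apply: submx_trans socA _; apply: leastU => I [/andP[]].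
  - move=> x Gx nZx; apply: annih => [|v fix_v]; first exact: gset_class_center.
    rewrite (fixed_row_mul_gset _ fix_v) ?class_subG //.
    suff /eqP-> : (#|x ^: G|%:R == 0 :> F) by rewrite scale0r.
    rewrite -(dvdn_pcharf charF) -index_cent1.
    have: p.-nat #|G : 'C_G[x]| by rewrite (pnat_dvd (dvdn_indexg _ _)).
    case/p_natP=> [] [/eqP | k ->]; last by rewrite expnS dvdn_mulr.
    rewrite indexg_eq1 subsetI subxx sub_cent1 => cGx.
    by rewrite inE Gx cGx in nZx.
  - apply/subsetP=> z Zz; have [Gz _] := setIP Zz; rewrite inE Gz /=.
    rewrite -subr_eq0 -[X in _ - X]mulmx1 -mulmxBr; apply/eqP/annih=> [|v].
      rewrite linearB addmx_sub ?center_elt // eqmx_opp.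
      by rewrite -(repr_mx1 aG) center_elt // group1.
    by move/rfix_mxP=> fix_v; rewrite mulmxBr mulmx1 fix_v ?subrr.
case=> ZA annA fixA; have [-> | nzA] := eqVneq A 0; first by rewrite mem0mx.
have lineA B : (B \in 'Z(FG))%MS -> (A *m B \in mxvec A)%MS.
  rewrite -(classg_base_center F G) => /submxP[u /(canRL mxvecK)->].
  rewrite mulmx_sum_row linear_sum mulmx_sumr linear_sum summx_sub //= => k _.
  rewrite linearZ -scalemxAr linearZ scalemx_sub //= rowK mxvecK.
  have /imsetP[x Gx ->] := enum_valP k.
  have [Zx | nZx] := boolP (x \in 'Z(G)); last first.
    by rewrite annA // linear0 sub0mx.
  have /setIP[_ /cent_classP->] := Zx.
  rewrite /gset_mx big_set1.
  by have /subsetP/(_ x Zx) := fixA; rewrite inE => /andP[_ /eqP->].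
have eqI : (<<mxvec A>> :=: mxvec A)%MS := genmxE _.
suff minI : minimal_ideal 'Z(FG)%MS <<mxvec A>>%MS.
  by rewrite (submx_trans _ (socU _ minI)) ?eqI.
split.
- have memI B : (B \in <<mxvec A>>)%MS = (B \in mxvec A)%MS by rewrite eqI.
  apply/and3P; split; first by rewrite eqI.
    apply/mulsmx_subP=> B C ZB; rewrite !memI => /sub_rVP[a].
    rewrite -linearZ => /(can_inj mxvecK)->.
    rewrite -scalemxAr linearZ scalemx_sub //=.
    by rewrite -(center_comm ZA) ?lineA ?center_ring.
  apply/mulsmx_subP=> B C; rewrite !memI => /sub_rVP[a].
  rewrite -linearZ => /(can_inj mxvecK)-> ZC.
  by rewrite -scalemxAl linearZ scalemx_sub //= lineA.
- by rewrite (eqmx_eq0 eqI) mxvec_eq0.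
move=> J _ nzJ sJI; rewrite sJI /= -(mxrank_leqif_sup sJI) eqn_leq mxrankS //=.
by rewrite eqI rank_rV mxvec_eq0 nzA lt0n mxrank_eq0.
Qed.

(** In an ideal of FG contained in the center, A x^-1 is central together with
    A, whence A x^-1 y^-1 x y = y^-1 A x^-1 x y = A.  Conversely, if the
    commutators fix A, then A g commutes with group elements, and as A is
    central, A g satisfies the other conditions of [mem_soc] along with A. *)
Lemma soc_idealP p : p \in [pchar F] -> p.-group G ->
  is_ideal FG (soc 'Z(FG)%MS) <->
  forall A : 'M_n, (A \in soc 'Z(FG)%MS)%MS -> G^`(1)%g \subset rstab aG A.
Proof.
move=> charF pG; have memS A := mem_soc A charF pG; split=> [|fix_soc].
  case/and3P=> _ _ idS A socA.
  have ZA : (A \in 'Z(FG))%MS by case/memS: socA.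
  rewrite gen_subG; apply/subsetP=> _ /imset2P[x y Gx Gy ->].
  rewrite inE groupR //=.
  have /memS[ZAx _ _] : (A *m aG x^-1%g \in soc 'Z(FG)%MS)%MS.
    by rewrite (mulsmx_subP idS) ?envelop_mx_id ?groupV.
  rewrite commgEl conjgE !repr_mxM ?groupM ?groupV // mulmxA.
  rewrite mulmxA (center_comm ZAx) ?envelop_mx_id ?groupV //.
  rewrite (mulmxA _ (aG x)) -(mulmxA _ _ (aG x)) repr_mxKV //.
  by rewrite -(center_comm ZA) ?envelop_mx_id ?groupV // repr_mxKV.
have socZ : (soc 'Z(FG)%MS <= FG)%MS.
  by apply/memmx_subP=> A /memS[/center_ring].
have soc_mulr A B : (A \in soc 'Z(FG)%MS)%MS -> (B \in FG)%MS ->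
    (A *m B \in soc 'Z(FG)%MS)%MS.
  move=> socA /envelop_mxP[b ->].
  rewrite mulmx_sumr linear_sum summx_sub //= => g Gg.
  rewrite -scalemxAr linearZ scalemx_sub //=; apply/memS.
  have [ZA annA fixA] := (memS A).1 socA.
  have ZAg : (A *m aG g \in 'Z(FG))%MS.
    apply: centerP => [|x Gx].
      by rewrite envelop_mxM ?envelop_mx_id //; apply: center_ring.
    rewrite mulmxA -(center_comm ZA) ?envelop_mx_id // -!mulmxA -!repr_mxM //.
    have /subsetP/(_ [~ g^-1, x^-1]%g) := fix_soc A socA.
    rewrite derg1 mem_commg ?groupV // inE => /(_ isT)/andP[_ /eqP fixAc].
    rewrite -{2}fixAc -mulmxA -repr_mxM ?groupM ?groupR ?groupV //.
    congr (_ *m aG _); rewrite commgEl conjgE !invgK !mulgA.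
    by rewrite !mulgKV.
  split=> // [x Gx nZx | ].
    rewrite -mulmxA -(center_comm (gset_class_center Gx)) ?envelop_mx_id //.
    by rewrite mulmxA annA ?mul0mx.
  apply/subsetP=> z Zz; have /setIP[Gz _] := Zz.
  have := subsetP fixA z Zz; rewrite !inE Gz /= => /eqP fixAz.
  rewrite -mulmxA -(center_comm (center_elt Zz)) ?envelop_mx_id //.
  by rewrite mulmxA fixAz.
apply/and3P; split=> //; apply/mulsmx_subP=> A B; last exact: soc_mulr.
move=> RA socB; have [ZB _ _] := (memS B).1 socB.
by rewrite -(center_comm ZB RA) soc_mulr.
Qed.

(** * Products of class sums and subgroup sums *)

Lemma gset_mul_group (S : {set gT}) (N : {group gT}) :
  S \subset G -> N \subset G ->
  gset S *m gset N = \sum_(h in G) #|S :&: (h *: N)%g|%:R *: aG h.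
Proof.
move=> sSG sNG; rewrite {1}/gset_mx mulmx_suml.
transitivity (\sum_(f in S) \sum_(h in G | h \in (f *: N)%g) aG h).
  apply: eq_bigr => f Sf; have Gf := subsetP sSG f Sf.
  rewrite gset_mull //; apply: eq_bigl => h; apply/idP/andP=> [fNh | [] //].
  by split=> //; case/lcosetP: fNh => y Ny ->; rewrite groupM // (subsetP sNG).
rewrite (exchange_big_dep (mem G)) //=; last by move=> f h _ /andP[].
apply: eq_bigr => h Gh; rewrite (eq_bigl (mem (S :&: (h *: N)%g))) => [|f].
  by rewrite sumr_const scaler_nat.
by rewrite /= Gh inE !mem_lcoset -[in RHS]groupV invMg invgK.
Qed.

Lemma gset_class_mul0 (p : nat) (N : {group gT}) x :
  p.-group G -> p \in [pchar F] -> N <| G -> x \in G ->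
  (exists2 t, t \in G & (x ^ t != x) && (x ^ t \in x *: N))%g ->
  gset (x ^: G) *m gset N = 0.
Proof.
move=> pG charF nsNG Gx coll.
rewrite gset_mul_group ?class_subG ?normal_sub // big1 // => h Gh.
have := dvdn_card_class_coset h pG nsNG Gx coll.
by rewrite (dvdn_pcharf charF) => /eqP->; rewrite scale0r.
Qed.

(** By conjugation, no two elements of the class share a coset of N. *)
Lemma gset_class_mul_coset (N : {group gT}) x :
  N <| G -> x \in G ->
  (forall t, t \in G -> (x ^ t \in x *: N)%g -> x ^ t = x)%g ->
  gset (x ^: G) *m gset N = gset (x ^: G * N)%g.
Proof.
move=> /andP[sNG nNG] Gx fix_x; have sCG := class_subG Gx (subxx G).
have sCNG : (x ^: G * N \subset G)%g by rewrite mul_subG.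
rewrite gset_mul_group // (bigID (mem (x ^: G * N)%g)) /= [X in _ + X]big1.
  rewrite addr0 /gset_mx; apply: eq_big => [h | h /andP[Gh]].
    by rewrite andb_idl // => /(subsetP sCNG).
  case/mulsgP=> f y /imsetP[s Gs def_f] Ny def_h.
  suff -> : x ^: G :&: (h *: N)%g = [set f] by rewrite cards1 scale1r.
  have -> : (h *: N = f *: N)%g.
    by apply/esym/lcoset_eqP; rewrite def_h mem_lcoset invMg mulgKV groupV.
  apply/setP=> e; rewrite inE in_set1.
  apply/andP/eqP=> [[/imsetP[r Gr ->]] | ->]; last first.
    by rewrite lcoset_refl def_f memJ_class.
  rewrite -[(x ^ r)%g](conjgKV s) def_f conj_mem_lcoset ?(subsetP nNG) //.
  move=> xrN; rewrite -conjgM in xrN.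
  by rewrite -(conjgM x r) (fix_x _ _ xrN) ?groupM ?groupV.
move=> h /andP[Gh nSh]; suff -> : x ^: G :&: (h *: N)%g = set0.
  by rewrite cards0 scale0r.
apply: contraNeq nSh => /set0Pn[f /setIP[Cf hNf]].
apply/mulsgP; exists f (f^-1 * h)%g; rewrite ?mulKVg //.
by rewrite -groupV invMg invgK -mem_lcoset.
Qed.

(** If the class C of x has two elements in one coset of N, then C^+ N^+ = 0.
    Otherwise C^+ N^+ = (CN)^+, and the right translations preserving CN which
    lie in K form a group between N and K.  It contains the commutator [x, t],
    as K/N is central; if t does not commute with x, this commutator is not in
    N, so all of K preserves CN. *)
Lemma gset_class_annihilated (p : nat) (N K : {group gT}) x z :
  p.-group G -> p \in [pchar F] -> N <| G -> N \subset K -> prime #|K : N| ->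
  [~: K, G] \subset N -> G^`(1)%g \subset K ->
  x \in G -> x \notin 'Z(G) -> z \in K -> z \in G ->
  gset (x ^: G) *m (gset N *m (aG z - 1%:M)) = 0.
Proof.
move=> pG charF nsNG sNK pr_iKN sKGN sG'K Gx nZx Kz Gz.
have [sNG nNG] := andP nsNG; have sCG := class_subG Gx (subxx G).
rewrite mulmxA.
have [fix_x | ] :=
    boolP [forall t in G, (x ^ t \in x *: N) ==> (x ^ t == x)]%g.
  rewrite gset_class_mul_coset //; last first.
    move=> t Gt xt; apply/eqP.
    by have /forall_inP/(_ t Gt)/implyP := fix_x; apply.
  set S := (_ * _)%g; rewrite mulmxBr mulmx1 gset_mulr ?mul_subG //.
  suff sKS : K \subset 'N(S | 'R).
    by rewrite -rcosetE [rcoset S z](astabs_setact (subsetP sKS z Kz)) subrr.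
  have /maxgroupP[_ maxN] := p_index_maximal sNK pr_iKN.
  have [//|nKL] := boolP (K \subset 'N(S | 'R)).
  have [t Gt ncxt] : exists2 t, t \in G & (x ^ t != x)%g.
    apply/exists_inP; apply: contraR nZx => /exists_inPn cxG.
    rewrite inE Gx; apply/centP=> t Gt; apply/commgP/conjg_fixP.
    by apply/eqP; rewrite -[_ == _]negbK cxG.
  have defN : K :&: 'N(S | 'R) = N.
    apply: (maxN [group of K :&: 'N(S | 'R)]).
      by rewrite /= properE subsetIl subsetI subxx.
    rewrite subsetI sNK; apply/subsetP=> y Ny; rewrite !inE /=.
    by apply/subsetP=> s Ss; rewrite inE /= /S -(mulGid N) mulgA mem_mulg.
  have Kxt : [~ x, t]%g \in K by rewrite (subsetP sG'K) // mem_commg.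
  have: [~ x, t]%g \in N.
    rewrite -defN inE Kxt !inE /=.
    apply/subsetP=> _ /mulsgP[_ y /imsetP[r Gr ->] Ny ->].
    rewrite inE /=; set k := [~ x, t]%g in Kxt *.
    have Gk : k \in G by rewrite groupR.
    (* Modulo N, k is its own conjugate k ^ r, and x ^ r * k ^ r is again a
       conjugate of x. *)
    have xtr : (x ^ (t * r) = x ^ r * k ^ r)%g.
      by rewrite -conjMg conjgM /k commgEl mulKVg.
    have -> : (x ^ r * y * k = x ^ (t * r) * ([~ k, r]^-1 * y ^ k))%g.
      rewrite xtr; move: k {Kxt Gk xtr} => k.
      rewrite -(mulgA (x ^ r)%g) -(mulgA (x ^ r)%g); congr (_ * _)%g.
      by rewrite (conjg_mulR k r) -mulgA mulKVg -conjgC.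
    apply: mem_mulg; first by rewrite memJ_class ?groupM.
    rewrite groupM ?groupV //; last by rewrite memJ_norm // (subsetP nNG).
    by rewrite (subsetP sKGN) // mem_commg.
  rewrite commgEl -mem_lcoset => xtN.
  by have /forall_inP/(_ t Gt) := fix_x; rewrite xtN (negPf ncxt).
case/forall_inPn=> t Gt; rewrite negb_imply => /andP[xtN xt_x].
rewrite (gset_class_mul0 pG charF nsNG Gx) ?mul0mx //.
by exists t; rewrite ?xt_x.
Qed.

Lemma gring_proj_gset (S : {set gT}) x :
  S \subset G -> x \in G -> @gring_proj F _ G x (gset S) = (x \in S)%:R.
Proof.
move=> sSG Gx; rewrite /gset_mx linear_sum /=.
rewrite (eq_bigr (fun y => (x == y)%:R)) => [|y Sy]; last first.
  by rewrite gring_projE // (subsetP sSG).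
have [Sx | nSx] := boolP (x \in S).
  rewrite (big_setD1 x) //= eqxx big1 ?addr0 // => y.
  by rewrite !inE eq_sym => /andP[/negPf->].
by rewrite big1 // => y Sy; case: eqP nSx => // ->; rewrite Sy.
Qed.

Lemma rstab_gset_group (N : {group gT}) : N \subset G -> rstab aG (gset N) = N.
Proof.
move=> sNG; apply/setP=> c; rewrite inE; apply/andP/idP=> [[Gc] | Nc].
  rewrite gset_mulr // => /eqP/(congr1 (@gring_proj F _ G c)).
  rewrite !gring_proj_gset ?mul_subG ?sub1set // rcoset_refl.
  by case: (c \in N) => // /eqP; rewrite oner_eq0.
have Gc := subsetP sNG c Nc; split=> //.
by rewrite gset_mulr // rcoset_id.
Qed.

(** If z fixes N^+(z - 1), then N^+(z^2 - 2z + 1) = 0; as z is not in N, the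
    coefficient of this element at 1 is 1 or 2, according as z^2 is not or is
    in N. *)
Lemma gset_mul_subr1_fixed p (N : {group gT}) z :
  p \in [pchar F] -> N \subset G -> z \in G -> z \notin N ->
  z \in rstab aG (gset N *m (aG z - 1%:M)) -> p = 2.
Proof.
move=> charF sNG Gz nNz; rewrite inE Gz /= mulmxBr mulmx1 mulmxBl.
rewrite !gset_mulr ?mul_subG ?sub1set // => /eqP.
move/(congr1 (@gring_proj F _ G 1%g)).
rewrite !raddfB /= !gring_proj_gset ?mul_subG ?sub1set //.
rewrite -rcosetM !mem_rcoset !mul1g !groupV group1 (negPf nNz).
case: (_ \in N); last by move/eqP; rewrite subrr sub0r eq_sym oppr_eq0 oner_eq0.
rewrite subr0 sub0r => /(congr1 (fun M : 'M_1 => M 0 0)); rewrite !mxE => /eqP.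
rewrite -subr_eq0 opprK -(natrD _ 1 1).
rewrite -(dvdn_pcharf charF) => /(@dvdn_leq p 2 isT) le_p2.
by apply/eqP; rewrite eqn_leq le_p2 prime_gt1 // (pcharf_prime charF).
Qed.

Lemma gset_mul_subr1_center (N : {group gT}) z :
  N <| G -> z \in G -> [~: [set z], G] \subset N ->
  (gset N *m (aG z - 1%:M) \in 'Z(FG))%MS.
Proof.
move=> nsNG Gz sN; have [sNG nNG] := andP nsNG.
have ZN := gset_normal_center nsNG.
rewrite mulmxBr mulmx1 linearB addmx_sub ?eqmx_opp //.
apply: centerP => [|x Gx].
  by rewrite envelop_mxM ?gset_ring ?envelop_mx_id.
rewrite mulmxA -(center_comm ZN) ?envelop_mx_id // -!mulmxA -!repr_mxM //.
rewrite !gset_mulr ?groupM //; congr (gset _); apply/rcoset_eqP.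
have -> : (z * x)%g = ([~ z, x] ^ (x * z)^-1 * (x * z))%g.
  by rewrite -conjgCV -commgC.
rewrite mem_rcoset mulgK memJ_norm; last first.
  by rewrite (subsetP nNG) // groupV groupM.
by rewrite (subsetP sN) // mem_commg ?set11.
Qed.

(** * When the socle is an ideal *)

(** If z in G' is not in N, then N^+(z - 1) lies in the socle, but z does not
    fix it. *)
Lemma soc_ideal_odd p : p \in [pchar F] -> p.-group G -> p != 2 ->
  is_ideal FG (soc 'Z(FG)%MS) -> G^`(1)%g \subset 'Z(G).
Proof.
move=> charF pG p_neq2 /(soc_idealP charF pG) fix_soc.
apply: contraNT p_neq2 => nsG'Z; pose K := (G^`(1) <*> 'Z(G))%G.
have nsKG : K <| G by rewrite normalY ?der_normal ?center_normal.
have sZK : 'Z(G) \subset K := joing_subr _ _.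
have sG'K : G^`(1)%g \subset K := joing_subl _ _.
have prZK : 'Z(G) \proper K.
  by rewrite properE sZK (contra _ nsG'Z) // => /(subset_trans sG'K).
have [N [nsNG sZN sNK iKN sKGN]] :=
  normal_index_p pG nsKG (center_normal G) prZK.
have p_pr := pcharf_prime charF.
have /subsetPn[z G'z nNz] : ~~ (G^`(1)%g \subset N).
  apply: contraL (prime_gt1 p_pr) => sG'N.
  by rewrite -iKN -leqNgt leq_eqVlt indexg_eq1 join_subG sG'N sZN.
have Gz := subsetP (der_sub 1 G) z G'z.
have Kz := subsetP sG'K z G'z.
have sNG := normal_sub nsNG.
pose A := gset N *m (aG z - 1%:M).
have ZA : (A \in 'Z(FG))%MS.
  apply: gset_mul_subr1_center => //; apply: subset_trans sKGN.
  by rewrite commSg // sub1set.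
apply/eqP/(gset_mul_subr1_fixed charF sNG Gz nNz).
apply: (subsetP (fix_soc A _) z G'z); apply/(mem_soc _ charF pG).
split=> // [x Gx nZx | ].
  rewrite (center_comm ZA) ?gset_ring ?class_subG //.
  by rewrite (gset_class_annihilated pG charF nsNG sNK) ?iKN.
apply/subsetP=> w Zw; have [Gw _] := setIP Zw; rewrite inE Gw /=.
rewrite (center_comm ZA) ?envelop_mx_id // /A mulmxA.
by rewrite gset_mull // lcoset_id // (subsetP sZN).
Qed.

(** Here N^+ itself lies in the socle, so its stabilizer N would contain G'. *)
Lemma soc_ideal_two : 2 \in [pchar F] -> 2.-group G ->
  is_ideal FG (soc 'Z(FG)%MS) -> G^`(1)%g \subset (Y G * 'Z(G))%g.
Proof.
move=> charF pG /(soc_idealP charF pG) fix_soc.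
have nYZ : 'Z(G) \subset 'N(Y G).
  by rewrite (subset_trans (center_sub G)) ?normal_norm ?Y_normal.
rewrite -norm_joinEr //; apply: contraT => nsG'M.
pose M := (Y G <*> 'Z(G))%G; pose K := (G^`(1) <*> 'Z(G))%G.
have nsMG : M <| G by rewrite normalY ?Y_normal ?center_normal.
have nsKG : K <| G by rewrite normalY ?der_normal ?center_normal.
have sG'K : G^`(1)%g \subset K := joing_subl _ _.
have prMK : M \proper K.
  rewrite properE genS ?setSU ?Y_sub_der1 //=.
  by rewrite (contra _ nsG'M) // => /(subset_trans sG'K).
have [N [nsNG sMN sNK iKN _]] := normal_index_p pG nsKG nsMG prMK.
have [sYN sZN] : Y G \subset N /\ 'Z(G) \subset N.
  by apply/andP; rewrite -join_subG.
have sNG := normal_sub nsNG.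
suff sG'N : G^`(1)%g \subset N.
  have : K \subset N by rewrite join_subG sG'N.
  by rewrite -indexg_eq1 iKN.
rewrite -(rstab_gset_group sNG); apply: fix_soc; apply/(mem_soc _ charF pG).
split=> [|x Gx nZx|]; first exact: gset_normal_center.
  rewrite (center_comm (gset_normal_center nsNG)) ?gset_ring ?class_subG //.
  apply: (gset_class_mul0 pG charF nsNG Gx).
  exact: (exists_conj_in_lcoset nsNG sNK iKN).
by rewrite rstab_gset_group.
Qed.

Lemma class2_soc_ideal p : p \in [pchar F] -> p.-group G ->
  G^`(1)%g \subset 'Z(G) -> is_ideal FG (soc 'Z(FG)%MS).
Proof.
move=> charF pG sG'Z; apply/(soc_idealP charF pG) => A.
by case/(mem_soc _ charF pG)=> _ _; apply: subset_trans.
Qed.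

(** In characteristic 2, A (f + g) = 0 means A f = A g. *)
Lemma Y_fixes_soc (A : 'M_n) : 2 \in [pchar F] -> 2.-group G ->
  (A \in soc 'Z(FG)%MS)%MS -> Y G \subset rstab aG A.
Proof.
move=> charF pG /(mem_soc _ charF pG)[ZA annA _].
rewrite gen_subG; apply/subsetP=> _ /imset2P[f g Gf /[!inE] + ->].
case/and3P=> Gg /imsetP[x Gx def_fg] /eqP card2.
have nZx : x \notin 'Z(G).
  apply/negP=> /setIP[_ /cent_classP def_x].
  by move: card2; rewrite def_fg def_x cards1.
have := annA x Gx nZx; rewrite -def_fg /gset_mx.
have ne_fg : f != g by move: card2; rewrite cards2; case: eqP.
rewrite big_setU1 ?in_set1 //= big_set1 mulmxDr.
have -> : A *m aG g = - (A *m aG g).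
  apply/eqP; rewrite -addr_eq0 -mulr2n -scaler_nat.
  by rewrite (pcharf0 charF) scale0r.
move/eqP; rewrite subr_eq0 => /eqP eqA.
rewrite groupM ?groupV //= repr_mxM ?groupV // mulmxA eqA.
by rewrite repr_mxK.
Qed.

Lemma Y_soc_ideal : 2 \in [pchar F] -> 2.-group G ->
  G^`(1)%g \subset (Y G * 'Z(G))%g -> is_ideal FG (soc 'Z(FG)%MS).
Proof.
move=> charF pG sG'YZ; apply/(soc_idealP charF pG) => A socA.
apply: subset_trans sG'YZ _; rewrite mul_subG ?Y_fixes_soc //.
by case/(mem_soc _ charF pG): socA.
Qed.

End Socle.

End GroupAlgebra.

Theorem theorem2 (F : fieldType) (p : nat) (gT : finGroupType) (G : {group gT})
    (hF : p \in [pchar F]%R) (hG : (p.-group G)%g) :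
  let FG := group_ring F G in
  (is_ideal FG (soc 'Z(FG)%MS) <->
     (nil_class G <= 2)%N \/
     (p = 2 /\ (G^`(1) \subset Y G * 'Z(G))%g)) /\
  (is_ideal FG (soc 'Z(FG)%MS) -> (abelian G^`(1))%g).
Proof.
move=> FG; rewrite nil_class2.
have ideal_cases : is_ideal FG (soc 'Z(FG)%MS) ->
    (G^`(1) \subset 'Z(G))%g \/ (p = 2 /\ (G^`(1) \subset Y G * 'Z(G))%g).
  move=> idS; have [p2 | p_neq2] := eqVneq p 2; last first.
    by left; apply: soc_ideal_odd hF hG p_neq2 idS.
  by right; split=> //; subst p; apply: soc_ideal_two hF hG idS.
split; last first.
  case/ideal_cases=> [sG'Z | [_]]; last exact: abelian_der1.
  exact: abelianS sG'Z (center_abelian G).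
split=> // -[sG'Z | [p2 sG'YZ]]; first exact: class2_soc_ideal hF hG sG'Z.
by subst p; apply: Y_soc_ideal.
Qed.
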